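(* Let $X$ be a finite alphabet with $|X|>1$, and let $G_1$ be the group of all automata transformations $g$ over $X$ such that $NC(g,l)=o(|X|^l)$ as $l\to\infty$, acting on the set $X^w$ of infinite words over $X$. Then $X^w$ is not $G_1$-paradoxical.
   Context: $X$ is a fixed finite alphabet with $|X|>1$; $X^*$ is the set of finite words over $X$ (including the empty word $\emptyset$), $X^l$ the set of words of length $l$, and $X^w$ the set of infinite words $x_1x_2\ldots$ with $x_i\in X$. An automaton $A=(X,Q,\pi,\lambda)$ consists of the alphabet $X$, a (possibly infinite) set of states $Q$, a transition function $\pi:Q\times X\to Q$ and an output function $\lambda:Q\times X\to X$. These are extended to words by $\pi(q,\emptyset)=q$, $\pi(q,xv)=\pi(\pi(q,x),v)$, $\lambda(q,\emptyset)=\emptyset$, $\lambda(q,xv)=\lambda(q,x)\lambda(\pi(q,x),v)$ for $x\in X$, $v\in X^*$; $\lambda(q,\cdot)$ is extended in the same way to $X^w$. All automata are assumed invertible: for each $q\in Q$ the map $\lambda(q,\cdot)$ is a bijection of $X$. An automata transformation is a map $g=\lambda(q,\cdot)$ defined by an automaton with a fixed state $q$ (an initial automaton $A_q$); it acts bijectively on each $X^l$, on $X^*$ and on $X^w$. Pairwise distinct states $g_1,\dots,g_n$ of one automaton form an unconditional cycle (UC) of length $n$ if $\pi(g_i,x)=g_{i+1}$ for $1\le i<n$ and $\pi(g_n,x)=g_1$, for every $x\in X$. A word $v\in X^*$ moves $A_q$ to a UC if, starting in state $q$ and reading $v$, the automaton $A$ gets into one of the states of a UC after processing the first $s$ letters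 of $v$, for some $s$ not exceeding the length of $v$. For an automata transformation $g$ given by an initial automaton $A_q$, $NC(g,l)$ is the number of words in $X^l$ that do not move $A_q$ to any UC. $G_1$ is the set of automata transformations $g$ that can be given by an initial automaton for which $NC(g,l)=o(|X|^l)$, $l\to\infty$; it is a group under composition. For a group $G$ acting on a set $Y$, a subset $E\subseteq Y$ is $G$-paradoxical if for some positive integers $m,n$ there are pairwise disjoint subsets $A_1,\dots,A_n,B_1,\dots,B_m$ of $E$ and elements $g_1,\dots,g_n,h_1,\dots,h_m\in G$ such that $E=\bigcup_{i=1}^n g_i(A_i)=\bigcup_{j=1}^m h_j(B_j)$. *)

(* Defs.v *)
From HB Require Import structures.
From mathcomp Require Import all_boot all_order all_algebra.
From mathcomp Require Import all_classical all_reals all_analysis.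

Set Implicit Arguments.
Unset Strict Implicit.
Unset Printing Implicit Defensive.

Import Order.TTheory GRing.Theory Num.Theory.
Import numFieldNormedType.Exports.

Local Open Scope classical_set_scope.

Record automaton (X : finType) := Automaton {
  state : Type;
  trans : state -> X -> state;
  out : state -> X -> X;
  out_bij : forall q, bijective (out q)
}.

Section Automata.
Variables (X : finType) (A : automaton X).
Implicit Types (q : state A) (v : seq X) (w : nat -> X).

Definition run q v : state A := foldl (@trans X A) q v.

Fixpoint out_word q v : seq X :=
  if v is x :: v' then out q x :: out_word (trans q x) v' else [::].

(* Infinite words are functions nat -> X. *)
Definition out_inf q w : nat -> X :=
  fun i => out (run q (mkseq w i)) (w i).

Lemma mkseqS w n : mkseq w n.+1 = w 0 :: mkseq (w \o succn) n.
Proof. by rewrite /mkseq /= -add1n iotaDl -map_comp. Qed.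

(* out_inf is the extension of out_word to infinite words. *)
Lemma mkseq_out_inf q w n :
  mkseq (out_inf q w) n = out_word q (mkseq w n).
Proof.
elim: n q w => [//|n IHn] q w; rewrite !mkseqS /= -IHn; congr (_ :: _).
by apply: eq_mkseq => i /=; rewrite /out_inf mkseqS.
Qed.

Lemma size_out_word q v : size (out_word q v) = size v.
Proof. by elim: v q => //= x v IHv q; rewrite IHv. Qed.

Lemma take_out_word q v s : take s (out_word q v) = out_word q (take s v).
Proof. by elim: v q s => [|x v IHv] q [|s] //=; rewrite IHv. Qed.

(* ordS is the cyclic successor on 'I_n. *)
Definition is_UC n (c : 'I_n -> state A) : Prop :=
  [/\ (0 < n)%N, injective c & forall i x, trans (c i) x = c (ordS i)].

Definition on_UC q : Prop :=
  exists n (c : 'I_n -> state A), is_UC c /\ exists i, c i = q.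

Definition moves_to_UC q v : Prop :=
  exists s, (s <= size v)%N /\ on_UC (run q (take s v)).

Definition NC q (l : nat) : nat :=
  #|[pred v : l.-tuple X | ~~ `[< moves_to_UC q v >]]|.

Lemma on_UC_periodic q : on_UC q <->
  exists n (f : nat -> state A), [/\ (0 < n)%N, f 0 = q,
    forall k, f (k + n)%N = f k & forall k x, trans (f k) x = f k.+1].
Proof.
split=> [[n [c [[n0 cI cS] [i ciq]]]]|[n [f [n0 f0 fp fS]]]].
  have mlt k : ((i + k) %% n < n)%N by rewrite ltn_mod.
  exists n, (fun k => c (Ordinal (mlt k))); split => //.
  - by rewrite -ciq; congr c; apply: val_inj; rewrite /= addn0 modn_small.
  - by move=> k; congr c; apply: val_inj; rewrite /= addnA modnDr.
  - move=> k x; rewrite cS; congr c; apply: val_inj.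
    by rewrite /= -addn1 modnDml addn1 addnS.
case: (pickP (@predT X)) => [x0 _|X0]; last first.
  exists 1%N, (fun=> q); split; last by exists ord0.
  by split => // [i j _|i x]; [rewrite !ord1|have := X0 x].
pose P m := (0 < m)%N && `[< forall k, f (k + m)%N = f k >].
have exP : exists m, P m by exists n; rewrite /P n0; apply/asboolP.
case: (ex_minnP exP) => m /andP[{}m0 /asboolP {}mp] mmin.
have fshift i j k : f i = f j -> f (i + k)%N = f (j + k)%N.
  move=> fij; elim: k => [|k IHk]; first by rewrite !addn0.
  by rewrite !addnS -(fS _ x0) IHk fS.
have lt_neq i j : (i < j)%N -> (j < m)%N -> f i <> f j.
  move=> ij jm fij; have /mmin : P (j - i)%N.
    apply/andP; split; first by rewrite subn_gt0.
    apply/asboolP => k.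
    have mulp a b : f (b + a * m)%N = f b.
      by elim: a => [|a IHa]; rewrite ?addn0 // mulSn addnCA addnC mp.
    have im : (i <= i * m)%N by rewrite leq_pmulr.
    have := fshift i j (k + i * m - i)%N fij.
    have e1 : (i + (k + i * m - i) = k + i * m)%N.
      by rewrite subnKC // (leq_trans im) // leq_addl.
    have e2 : (j + (k + i * m - i) = k + (j - i) + i * m)%N.
      rewrite -{1}(subnKC (ltnW ij)) addnAC e1 addnAC //.
    by rewrite e1 e2 !mulp.
  by rewrite leqNgt (leq_ltn_trans (leq_subr _ _) jm).
exists m, (fun i : 'I_m => f i); split; last by exists (Ordinal m0).
split=> // [i j fij|i x].
  apply: val_inj; case: (ltngtP i j) => // ij.
    by case: (lt_neq _ _ ij (ltn_ord j)).
  by case: (lt_neq _ _ ij (ltn_ord i)).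
rewrite fS /=; case: (ltnP i.+1 m) => im; first by rewrite modn_small.
have -> : i.+1 = m by apply/eqP; rewrite eqn_leq im ltn_ord.
by rewrite modnn -{1}[m]add0n mp.
Qed.

Lemma on_UC_run q v : on_UC q -> on_UC (run q v).
Proof.
elim: v q => //= x v IHv q [n [c [cU [i <-]]]]; apply: IHv.
by case: (cU) => _ _ ->; exists n, c; split => //; exists (ordS i).
Qed.

Lemma moves_to_UCE q v : moves_to_UC q v <-> on_UC (run q v).
Proof.
split=> [[s [_ sU]]|vU].
  by rewrite -(cat_take_drop s v) /run foldl_cat; apply: on_UC_run sU.
by exists (size v); rewrite take_size.
Qed.

End Automata.

Section Identity.
Variable X : finType.

Definition id_automaton : automaton X :=
  @Automaton X unit (fun q _ => q) (fun _ => id) 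
    (fun _ => @Bijective X X id id (fun=> erefl) (fun=> erefl)).

Lemma id_automaton_NC l : NC (tt : state id_automaton) l = 0.
Proof.
apply: eq_card0 => v; rewrite !inE; apply/negbTE; rewrite negbK.
apply/asboolP/moves_to_UCE; exists 1%N, (fun=> tt); split.
  by split => // i j _; rewrite !ord1.
by exists ord0; case: (run _ _).
Qed.

End Identity.

Section Inverse.
Variables (X : finType) (A : automaton X).

Definition outV (q : state A) : X -> X := invF (bij_inj (out_bij q)).

Definition inv_automaton : automaton X :=
  @Automaton X (state A) (fun q x => trans q (outV q x)) outV
    (fun q => Bijective (f_invF (bij_inj (out_bij q))) (invF_f (bij_inj (out_bij q)))).

Notation B := inv_automaton.

Lemma run_inv (q : state A) v : run (q : state B) (out_word q v) = run q v.
Proof. by elim: v q => //= x v IHv q; rewrite /outV invF_f IHv. Qed.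

Lemma out_inf_invK (q : state A) : cancel (out_inf q) (out_inf (q : state B)).
Proof.
move=> w; apply/funext => i; rewrite /out_inf mkseq_out_inf run_inv.
exact: invF_f.
Qed.

Lemma run_invV (q : state A) v :
  run q (out_word (q : state B) v) = run (q : state B) v.
Proof. by elim: v q => //= x v IHv q; rewrite IHv. Qed.

Lemma out_inf_invVK (q : state A) : cancel (out_inf (q : state B)) (out_inf q).
Proof.
move=> w; apply/funext => i; rewrite /out_inf mkseq_out_inf run_invV.
exact: f_invF.
Qed.

Lemma out_word_invVK (q : state A) : cancel (out_word (q : state B)) (out_word q).
Proof. by move=> v; elim: v q => //= x v IHv q; rewrite IHv f_invF. Qed.

Lemma out_word_invK (q : state A) : cancel (out_word q) (out_word (q : state B)).
Proof. by move=> v; elim: v q => //= x v IHv q; rewrite /outV invF_f IHv. Qed.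

Lemma on_UC_inv (q : state A) : on_UC q -> on_UC (q : state B).
Proof.
move=> [n [c [[n0 cI cS] ciq]]]; exists n, c; split => //.
by split => // i x /=; rewrite cS.
Qed.

Lemma NC_inv (q : state A) l : (NC (q : state B) l <= NC q l)%N.
Proof.
have sz (v : l.-tuple X) : size (out_word (q : state B) v) == l.
  by rewrite size_out_word size_tuple.
pose f v : l.-tuple X := Tuple (sz v).
have fI : injective f.
  move=> u v /(congr1 val) /= /(congr1 (out_word q)).
  by rewrite !out_word_invVK; apply: val_inj.
rewrite /NC -(fintype.card_image fI); apply/subset_leq_card/fintype.subsetP => u.
move=> /fintype.imageP[v]; rewrite !inE => /asboolPn vU ->; apply/asboolPn => fU.
by apply/vU/moves_to_UCE/on_UC_inv; move/moves_to_UCE: fU; rewrite run_invV.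
Qed.

End Inverse.

Section Composition.
Variables (X : finType) (A B : automaton X).

Definition comp_automaton : automaton X :=
  @Automaton X (state A * state B)
    (fun q x => (trans q.1 (out q.2 x), trans q.2 x))
    (fun q => out q.1 \o out q.2)
    (fun q => bij_comp (out_bij q.1) (out_bij q.2)).

Notation C := comp_automaton.

Lemma run_comp (a : state A) (b : state B) v :
  run ((a, b) : state C) v = (run a (out_word b v), run b v).
Proof. by elim: v a b => //= x v IHv a b; rewrite IHv. Qed.

Lemma out_inf_comp (a : state A) (b : state B) :
  out_inf ((a, b) : state C) = out_inf a \o out_inf b.
Proof.
apply/funext => w; apply/funext => i.
by rewrite /= /out_inf mkseq_out_inf run_comp.
Qed.

Lemma on_UC_comp (a : state A) (b : state B) :
  on_UC a -> on_UC b -> on_UC ((a, b) : state C).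
Proof.
move=> /on_UC_periodic[n [f [n0 f0 fp fS]]] /on_UC_periodic[m [g [m0 g0 gp gS]]].
have fp' k i : f (k + i * n)%N = f k.
  by elim: i => [|i IHi]; rewrite ?addn0 // mulSnr addnA fp.
have gp' k i : g (k + i * m)%N = g k.
  by elim: i => [|i IHi]; rewrite ?addn0 // mulSnr addnA gp.
apply/on_UC_periodic; exists (n * m)%N, (fun k => (f k, g k)); split.
- by rewrite muln_gt0 n0.
- by rewrite f0 g0.
- by move=> k; rewrite gp' mulnC fp'.
- by move=> k x /=; rewrite fS gS.
Qed.

Lemma NC_comp (a : state A) (b : state B) l :
  (NC ((a, b) : state C) l <= NC a l + NC b l)%N.
Proof.
have sz (v : l.-tuple X) : size (out_word b v) == l.
  by rewrite size_out_word size_tuple.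
pose f v : l.-tuple X := Tuple (sz v).
have fI : injective f.
  move=> u v /(congr1 val) /= /(congr1 (out_word (b : state (inv_automaton B)))).
  by rewrite !out_word_invK; apply: val_inj.
pose D := [pred v : l.-tuple X | ~~ `[< moves_to_UC a (f v) >]].
pose E := [pred v : l.-tuple X | ~~ `[< moves_to_UC b v >]].
have DA : (#|D| <= NC a l)%N.
  rewrite -(fintype.card_image fI); apply/subset_leq_card/fintype.subsetP => u.
  by move=> /fintype.imageP[v Dv ->].
apply: (@leq_trans (#|D| + #|E|)%N); last by rewrite leq_add2r.
rewrite -cardUI; apply: leq_trans (leq_addr _ _).
apply/subset_leq_card/fintype.subsetP => v; rewrite !inE -negb_and; apply: contra.
move=> /andP[/asboolP/moves_to_UCE aU /asboolP/moves_to_UCE bU].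
by apply/asboolP/moves_to_UCE; rewrite run_comp; apply: on_UC_comp.
Qed.

End Composition.

Section G1.
Variables (R : realType) (X : finType).

(* R only serves as the codomain of the counting sequences in the little-o. *)
Definition in_G1 (g : (nat -> X) -> (nat -> X)) : Prop :=
  exists (A : automaton X) (q : state A), g = out_inf q /\
    (fun l => ((NC q l)%:R : R)%R) =o_\oo (fun l => ((#|X| ^ l)%:R : R)%R).

(* An automata transformation is identified with its action on infinite
   words, which determines its action on finite words (mkseq_out_inf). *)
Record G1 := MkG1 { G1_fun : (nat -> X) -> (nat -> X); G1P : in_G1 G1_fun }.

HB.instance Definition _ := gen_eqMixin G1.
HB.instance Definition _ := gen_choiceMixin G1.

Lemma G1_inj : injective G1_fun.
Proof.
by move=> [f fP] [g gP] /= fg; subst g; rewrite (Prop_irrelevance fP gP).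
Qed.

Lemma in_G1P g : in_G1 g <-> exists (A : automaton X) (q : state A),
  g = out_inf q /\ forall e : R, (0 < e)%R ->
    exists N, forall l, (N <= l)%N -> ((NC q l)%:R <= e * (#|X| ^ l)%:R :> R)%R.
Proof.
split=> -[A [q [-> h]]]; exists A, q; split => //.
  move=> e e0; move/eqoP: h => /(_ e e0)[N _ hN].
  by exists N => l /hN /=; rewrite !normr_nat.
apply/eqoP => e e0; have [N hN] := h e e0; exists N => // l /hN /=.
by rewrite !normr_nat.
Qed.

Lemma in_G1_id : in_G1 id.
Proof.
apply/in_G1P; exists (id_automaton X), tt; split => // e e0; exists 0 => l _.
by rewrite id_automaton_NC mulr_ge0 // ltW.
Qed.

Lemma in_G1_comp g h : in_G1 g -> in_G1 h -> in_G1 (g \o h).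
Proof.
move=> /in_G1P[A [a [-> ha]]] /in_G1P[B [b [-> hb]]]; apply/in_G1P.
exists (comp_automaton A B), (a, b); split; first by rewrite -out_inf_comp.
move=> e e0; have e20 : (0 < e / 2 :> R)%R by rewrite divr_gt0.
have [N hN] := ha _ e20; have [M hM] := hb _ e20; exists (maxn N M) => l.
rewrite geq_max => /andP[/hN lN /hM lM].
apply: (@le_trans _ _ ((NC a l)%:R + (NC b l)%:R)%R).
  by rewrite -natrD ler_nat; exact: NC_comp.
by rewrite {1}(splitr e) mulrDl lerD.
Qed.

Lemma in_G1_inv g : in_G1 g -> exists2 h, in_G1 h & cancel g h /\ cancel h g.
Proof.
move=> /in_G1P[A [a [-> ha]]]; exists (out_inf (a : state (inv_automaton A))).
  apply/in_G1P; exists (inv_automaton A), a; split => // e /ha[N hN].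
  exists N => l /hN; apply: le_trans; rewrite ler_nat; exact: NC_inv.
by split; [exact: out_inf_invK|exact: out_inf_invVK].
Qed.

Lemma G1_has_inv (g : G1) :
  exists h : G1, cancel (G1_fun g) (G1_fun h) /\ cancel (G1_fun h) (G1_fun g).
Proof. by have [h hP hK] := in_G1_inv (G1P g); exists (MkG1 hP). Qed.

Definition G1_one : G1 := MkG1 in_G1_id.
Definition G1_mul (g h : G1) : G1 := MkG1 (in_G1_comp (G1P g) (G1P h)).
Definition G1_inv (g : G1) : G1 := sval (cid (G1_has_inv g)).

Lemma G1_mulA : associative G1_mul.
Proof. by move=> f g h; apply: G1_inj. Qed.

Lemma G1_mul1 : left_id G1_one G1_mul.
Proof. by move=> g; apply: G1_inj. Qed.

Lemma G1_mulr1 : right_id G1_one G1_mul.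
Proof. by move=> g; apply: G1_inj. Qed.

Lemma G1_mulV : left_inverse G1_one G1_inv G1_mul.
Proof.
move=> g; apply: G1_inj; apply/funext => w /=.
by rewrite /G1_inv; case: cid => h [hK _] /=; rewrite hK.
Qed.

Lemma G1_mulrV : right_inverse G1_one G1_inv G1_mul.
Proof.
move=> g; apply: G1_inj; apply/funext => w /=.
by rewrite /G1_inv; case: cid => h [_ hK] /=; rewrite hK.
Qed.

HB.instance Definition _ :=
  isGroup.Build G1 G1_mulA G1_mul1 G1_mulr1 G1_mulV G1_mulrV.

End G1.

Record left_action (G : groupType) (Y : Type) := LeftAction {
  lact :> G -> Y -> Y;
  lact1 : forall y, lact 1%g y = y;
  lactM : forall g h y, lact (g * h)%g y = lact g (lact h y)
}.

Definition G1_action (R : realType) (X : finType) : left_action (G1 R X) (nat -> X) :=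
  @LeftAction (G1 R X) (nat -> X) (@G1_fun R X) (fun=> erefl) (fun _ _ _ => erefl).

Definition paradoxical (G : groupType) (Y : Type) (act : left_action G Y)
    (E : set Y) : Prop :=
  exists (n m : nat) (A : 'I_n -> set Y) (B : 'I_m -> set Y)
         (g : 'I_n -> G) (h : 'I_m -> G),
    [/\ (0 < n)%N, (0 < m)%N,
        (forall i, A i `<=` E) /\ (forall j, B j `<=` E),
        [/\ trivIset setT A, trivIset setT B & forall i j, A i `&` B j = set0]
      & E = \bigcup_i (act (g i) @` A i) /\
        E = \bigcup_j (act (h j) @` B j)].

(* Main.v *)
Require Import Defs.
From mathcomp Require Import all_boot all_order all_algebra.
From mathcomp Require Import all_classical all_reals all_analysis.
From mathcomp Require Import zify.

Import Order.TTheory GRing.Theory Num.Theory.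

Local Open Scope classical_set_scope.

(** Once an automaton has entered an unconditional cycle, it permutes the letters
    one position at a time, and these permutations depend only on the position and
    recur with the length n of the cycle.  It therefore maps p-periodic sequences
    to p-periodic sequences whenever n divides p.  An element of G_1 enters an
    unconditional cycle on all but a vanishing proportion of the prefixes of
    length l; as there are finitely many such prefixes, a common multiple p of
    their cycle lengths exists, and the element maps a sequence that is p-periodic
    from position l on to another such sequence, unless its prefix is one of the
    few bad ones ([in_G1_almost_preserves_periodic]).

    The sequences that are p-periodic from position l on form a finite set F with
    |X|^(l+p) elements.  For finitely many elements of G_1, a large l and a
    suitable p serve all of them at once, so that F is a Foelner set: all of these
    elements map most of F into F.  A paradoxical decomposition, on the other hand,
    supplies two injective maps with disjoint images, each acting at every point by
    one of finitely many group elements ([paradoxical_injection]).  If more than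
    half of F has a good prefix, the two copies of that part would have to fit
    disjointly in F, which is impossible ([doubling_bad_prefixes]). *)

(** Each point y of E lies in some g_i (A_i), and the first copy of y is sent to
    g_i^-1 y, in A_i; the second copy goes to some B_j in the same way.  Two images
    can agree only if they lie in the same piece, where a single group element
    acts. *)
Lemma paradoxical_injection (G : groupType) (Y : Type) (act : left_action G Y)
    (E : set Y) : paradoxical act E ->
  exists (I : finType) (s : I -> G) (k : bool -> Y -> I),
  forall b y b' y', E y -> E y' ->
    act (s (k b y)) y = act (s (k b' y')) y' -> (b, y) = (b', y').
Proof.
move=> [n [m [A [B [g [h [n0 m0 _ [Adisj Bdisj AB] [EA EB]]]]]]]].
have actVK (x : G) (y : Y) : act (x^-1)%g (act x y) = y.
  by rewrite -lactM mulVg lact1.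
have actKV (x : G) (y : Y) : act x (act (x^-1)%g y) = y.
  by rewrite -lactM mulgV lact1.
have /choice[ka kaP] (y : Y) : exists i, E y -> A i (act (g i)^-1%g y).
  have [|nEy] := pselect (E y); last by exists (Ordinal n0).
  by rewrite EA => -[i _ [a Aa <-]]; exists i => _; rewrite actVK.
have /choice[kb kbP] (y : Y) : exists j, E y -> B j (act (h j)^-1%g y).
  have [|nEy] := pselect (E y); last by exists (Ordinal m0).
  by rewrite EB => -[j _ [a Ba <-]]; exists j => _; rewrite actVK.
exists ('I_n + 'I_m)%type.
exists (fun i => match i with inl i => (g i)^-1 | inr j => (h j)^-1 end)%g.
exists (fun b y => if b then inl (ka y) else inr (kb y)).
have disj i j z : A i z -> B j z -> False.
  by move=> Az Bz; have : (A i `&` B j) z by []; rewrite AB.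
move=> [] y [] y' /= Ey Ey' eq_yy'.
- have kk : ka y = ka y'.
    by apply: (Adisj) => //; exists (act (g (ka y))^-1%g y); split;
      [exact: kaP|rewrite eq_yy'; exact: kaP].
  by rewrite -(actKV (g (ka y)) y) eq_yy' kk actKV.
- case: (disj (ka y) (kb y') (act (g (ka y))^-1%g y)); first exact: kaP.
  by rewrite eq_yy'; exact: kbP.
- case: (disj (ka y') (kb y) (act (g (ka y'))^-1%g y')); first exact: kaP.
  by rewrite -eq_yy'; exact: kbP.
have kk : kb y = kb y'.
  by apply: (Bdisj) => //; exists (act (h (kb y))^-1%g y); split;
    [exact: kbP|rewrite eq_yy'; exact: kbP].
by rewrite -(actKV (h (kb y)) y) eq_yy' kk actKV.
Qed.

Definition periodic_from {T : Type} (l p : nat) (y : nat -> T) : Prop :=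
  forall i, (l <= i)%N -> y (i + p)%N = y i.

Section Automata.
Variables (X : finType) (A : automaton X).
Implicit Types (q : state A) (w y : nat -> X).

Lemma out_inf_shift q y l i :
  out_inf q y (l + i) = out_inf (run q (mkseq y l)) (fun j => y (l + j)%N) i.
Proof.
rewrite /out_inf; congr (out _ _); rewrite /run -foldl_cat; congr foldl.
by rewrite /mkseq iotaD map_cat add0n -{2}[l]addn0 iotaDl -map_comp.
Qed.

(** On an unconditional cycle the current state depends only on the number of
    letters read, so the output at position i is a permutation, depending only on
    i modulo n, of the letter at position i. *)
Lemma on_UC_preserves_periodic q : on_UC q ->
  exists2 n, (0 < n)%N & forall p w,
    (n %| p)%N -> periodic_from 0 p w -> periodic_from 0 p (out_inf q w).
Proof.
move=> /on_UC_periodic[n [f [n0 <- fn fS]]]; exists n => // p w np wp i _.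
have runf k (v : seq X) : run (f k) v = f (k + size v)%N.
  elim: v k => [|x v IHv] k /=; first by rewrite addn0.
  by rewrite fS IHv addSnnS.
have fp : f (i + p)%N = f i.
  case/dvdnP: np => c ->; elim: c => [|c IHc]; first by rewrite addn0.
  by rewrite mulSnr addnA fn.
by rewrite /out_inf !runf !size_mkseq !add0n fp wp.
Qed.

End Automata.

(** The exceptional set D consists of the prefixes that reach no unconditional
    cycle, and n is a common multiple of the cycle lengths reached by the others.
    Both depend on l; only the bound on the proportion of D is uniform. *)
Lemma in_G1_almost_preserves_periodic (R : realType) (X : finType)
    (g : (nat -> X) -> nat -> X) (k : nat) : in_G1 R g ->
  exists N, forall l, (N <= l)%N ->
  exists (D : {set l.-tuple X}) (n : nat),
  [/\ (k * #|D| <= #|X| ^ l)%N, (0 < n)%N &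
    forall p y, (n %| p)%N -> periodic_from l p y ->
      [tuple of mkseq y l] \notin D -> periodic_from l p (g y)].
Proof.
move=> /in_G1P[A [q [-> small]]].
have e0 : (0 < k.+1%:R^-1 :> R)%R by rewrite invr_gt0 ltr0n.
have [N hN] := small _ e0; exists N => l /hN NCl.
have /choice[n nP] (v : l.-tuple X) : exists n, (0 < n)%N /\
    (on_UC (run q v) -> forall p w, (n %| p)%N -> periodic_from 0 p w ->
       periodic_from 0 p (out_inf (run q v) w)).
  (* The value 1 on bad prefixes keeps the product of all n v positive. *)
  have [/on_UC_preserves_periodic[n n0 nP]|nUC] := pselect (on_UC (run q v)).
    by exists n.
  by exists 1%N.
exists [set v : l.-tuple X | ~~ `[< moves_to_UC q v >]]%SET, (\prod_v n v)%N; split.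
- (* k.+1 instead of k makes the division legitimate when k = 0. *)
  apply: (@leq_trans (k.+1 * NC q l)).
    by rewrite leq_mul // cardsE.
  rewrite -(ler_nat R) natrM -ler_pdivlMl ?ltr0n //.
- by apply: prodn_gt0 => v; case: (nP v).
move=> p y np yp; rewrite inE negbK => /asboolP/moves_to_UCE qU i li.
have [n0 /(_ qU) pres] := nP [tuple of mkseq y l].
rewrite -(subnKC li) -addnA !(out_inf_shift _ _ q y).
apply: (pres p (fun j => y (l + j)%N)) => //.
  by apply: dvdn_trans np; rewrite (bigD1 [tuple of mkseq y l]) //= dvdn_mulr.
by move=> j _; rewrite addnA yp // leq_addr.
Qed.

Section EventuallyPeriodic.
Variables (X : finType) (l p : nat).
Hypotheses (x0 : X) (p0 : (0 < p)%N).

Definition eventually_periodic_word (t : l.-tuple X * p.-tuple X) : nat -> X :=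
  fun i => if (i < l)%N then nth x0 t.1 i else nth x0 t.2 ((i - l) %% p).

Lemma eventually_periodic_wordP t :
  periodic_from l p (eventually_periodic_word t).
Proof.
move=> i li; rewrite /eventually_periodic_word.
rewrite !ltnNge li (leq_trans li (leq_addr _ _)) /=.
by rewrite -addnBAC // modnDr.
Qed.

Lemma prefix_eventually_periodic_word t :
  [tuple of mkseq (eventually_periodic_word t) l] = t.1.
Proof.
apply: val_inj; apply: (@eq_from_nth _ x0) => [|i].
  by rewrite size_mkseq size_tuple.
by rewrite /= size_mkseq => il; rewrite nth_mkseq // /eventually_periodic_word il.
Qed.

Definition periodic_code (y : nat -> X) : l.-tuple X * p.-tuple X :=
  ([tuple of mkseq y l], [tuple of mkseq (fun j => y (l + j)%N) p]).

Lemma periodic_codeK y : periodic_from l p y ->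
  eventually_periodic_word (periodic_code y) = y.
Proof.
move=> yp; apply/funext => i; rewrite /eventually_periodic_word /=.
have [il|li] := ltnP i l; first by rewrite nth_mkseq.
rewrite nth_mkseq ?ltn_mod // -[in RHS](subnKC li) {2}(divn_eq (i - l) p).
elim: (_ %/ p)%N => [//|c IHc].
by rewrite mulSnr addnAC addnA yp // leq_addr.
Qed.

Lemma eventually_periodic_wordK : cancel eventually_periodic_word periodic_code.
Proof.
move=> t; rewrite /periodic_code prefix_eventually_periodic_word.
case: t => u w; congr (_, _); apply: val_inj.
apply: (@eq_from_nth _ x0) => [|i]; first by rewrite size_mkseq size_tuple.
rewrite /= size_mkseq => ip; rewrite nth_mkseq // /eventually_periodic_word.
by rewrite ltnNge leq_addr /= addKn modn_small.
Qed.

(** Here [f true] and [f false] are the two injections with disjoint images.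
    Restricted to sequences with prefixes outside D they stay among the sequences
    that are p-periodic from l on, so that
    2 (|X|^l - |D|) |X|^p <= |X|^l |X|^p. *)
Lemma doubling_bad_prefixes (D : {set l.-tuple X})
    (f : bool -> (nat -> X) -> nat -> X) :
  (forall b y b' y', f b y = f b' y' -> (b, y) = (b', y')) ->
  (forall b y, periodic_from l p y -> [tuple of mkseq y l] \notin D ->
     periodic_from l p (f b y)) ->
  (#|X| ^ l <= 2 * #|D|)%N.
Proof.
move=> finj fper; pose W := (l.-tuple X * p.-tuple X)%type.
pose good := [set z : bool * W | z.2.1 \notin D]%SET.
pose F (z : bool * W) : W := periodic_code (f z.1 (eventually_periodic_word z.2)).
have Fper z : z \in good ->
    periodic_from l p (f z.1 (eventually_periodic_word z.2)).
  rewrite inE => zD; apply: fper; first exact: eventually_periodic_wordP.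
  by rewrite prefix_eventually_periodic_word.
have Finj : {in good &, injective F}.
  move=> [b t] [b' t'] /Fper zp /Fper zp' /(congr1 eventually_periodic_word).
  rewrite /F !periodic_codeK // => /finj[-> /(can_inj eventually_periodic_wordK)].
  by move=> ->.
have : (#|good| <= #|{: W}|)%N by rewrite -(card_in_imset Finj) max_card.
have -> : good =
    (finset.setX [set: bool] (finset.setX (~: D) [set: p.-tuple X]))%SET.
  by apply/finset.setP => -[b [u w]]; rewrite !inE /= andbT.
rewrite !finset.cardsX !cardsT card_bool card_prod !card_tuple mulnA.
rewrite leq_pmul2r; last first.
  by rewrite expn_gt0; apply/orP; left; apply/card_gt0P; exists x0.
have <- : (#|D| + #|~: D|)%N = (#|X| ^ l)%N by rewrite cardsC card_tuple.
by rewrite mul2n -addnn leq_add2r mul2n -addnn leq_add2l.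
Qed.

End EventuallyPeriodic.

Theorem theorem2 (R : realType) (X : finType) (hX : (1 < #|X|)%N) :
  ~ paradoxical (G1_action R X) [set: nat -> X].
Proof.
move=> /paradoxical_injection[I [s [k kinj]]].
have [x0 _] : exists x0, x0 \in X by apply/card_gt0P/ltnW.
(* The factor 2 (|I| + 1) makes the union of the |I| bad sets smaller than half
   of X^l. *)
have /choice[N hN] (i : I) :=
  in_G1_almost_preserves_periodic R X (G1_fun (s i)) (2 * #|I|.+1) (G1P (s i)).
pose l := (\max_i N i)%N.
have /choice[D /choice[n hD]] (i : I) := hN i l (leq_bigmax i).
pose p := (\prod_i n i)%N.
have p0 : (0 < p)%N by apply: prodn_gt0 => i; case: (hD i).
pose B := (\bigcup_i D i)%SET.
have small : (2 * #|I|.+1 * #|B| <= #|I| * #|X| ^ l)%N.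
  apply: (@leq_trans (\sum_i 2 * #|I|.+1 * #|D i|)).
    rewrite -big_distrr leq_mul //=.
    apply: (big_ind2 (fun (U : {set l.-tuple X}) m => #|U| <= m)%N) => //.
      by rewrite cards0.
    move=> U u V v Uu Vv.
    by apply: leq_trans (leq_add Uu Vv); rewrite -cardsUI leq_addr.
  apply: leq_trans (_ : \sum_(i : I) #|X| ^ l <= _)%N; last by rewrite sum_nat_const.
  by apply: leq_sum => i _; case: (hD i).
have : (#|X| ^ l <= 2 * #|B|)%N.
  apply: (@doubling_bad_prefixes X l p x0 p0 B (fun b y => G1_fun (s (k b y)) y)).
    by move=> b y b' y'; apply: kinj.
  move=> b y yp yB; have [_ _ pres] := hD (k b y); apply: pres => //.
    by rewrite /p (bigD1 (k b y)) //= dvdn_mulr.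
  by apply: contra yB => yD; apply/finset.bigcupP; exists (k b y).
have : (0 < #|X| ^ l)%N by rewrite expn_gt0 ltnW.
nia.
Qed.
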